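(* Let $\sigma\ge 0$ and let $M$ be a stochastic multi-armed bandit instance with finite action set $\mathcal{A}$, $|\mathcal{A}|=A$, mean rewards $r(a)\in[0,1]$, and conditionally $\sigma^2$-sub-Gaussian reward noise (see context). Run the bandit version of the algorithm EQO+ (see context) with $c_{1,t}=c_1$ for all $t$, for a constant $c_1>0$, and $c_{2,t}=\infty$ for all $t$ (so the bonus is $c_1/N^t(a)$). Then for every horizon $T\in\mathbb{N}$ and every $\delta\in(0,1]$, the distributional regret satisfies $$\mathrm{Reg}_M^{\mathrm{Alg}}(T,\delta)\le \frac{\sigma^2 T\log\frac{4}{\delta}}{c_1}+\frac{3}{2}c_1A+\sum_{a\in\mathcal{A}}\mathrm{gap}(a).$$
   Context: Bandit model: at each time $t=1,2,\dots$ the agent chooses $a_t\in\mathcal{A}$ and observes a reward $R_t$. Conditionally on the history $\mathcal{F}_{t-1}$ (all past actions and rewards) and on $a_t$, $R_t-r(a_t)$ has mean zero and is $\sigma^2$-sub-Gaussian: $\mathbb{E}[\exp(\lambda(R_t-r(a_t)))\mid \mathcal{F}_{t-1},a_t]\le \exp(\lambda^2\sigma^2/2)$ for all $\lambda\in\mathbb{R}$. Let $a^*\in\arg\max_a r(a)$, $\mathrm{gap}(a)=r(a^* )-r(a)$, and $\mathrm{Reg}_M^{\mathrm{Alg}}(T)=\sum_{t=1}^T (r(a^* )-r(a_t))$. The distributional regret is $\mathrm{Reg}_M^{\mathrm{Alg}}(T,\delta):=\inf\{x\in\mathbb{R}: \mathbb{P}(\mathrm{Reg}_M^{\mathrm{Alg}}(T)>x)\le\delta\}$.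 Bandit EQO+ with input sequences $\{(c_{1,t},c_{2,t})\}_{t\ge1}$, values in $(0,\infty]$: for $t=1,\dots,A$ it plays each arm once. For $t>A$ it sets $N^t(a)=\sum_{i<t}\mathbf{1}\{a_i=a\}$, $\hat r^t(a)=\frac{1}{N^t(a)}\sum_{i<t}R_i\mathbf{1}\{a_i=a\}$, $b^t(a)=\min\{c_{1,t}/N^t(a),\,c_{2,t}/\sqrt{N^t(a)}\}$ (a term with parameter $\infty$ is simply absent), and plays $a_t\in\arg\max_a(\hat r^t(a)+b^t(a))$ (ties broken arbitrarily). *)

(* Defs.v *)
From HB Require Import structures.
From mathcomp Require Import all_boot all_order all_algebra.
From mathcomp Require Import all_classical all_reals all_analysis.
Set Implicit Arguments. Unset Strict Implicit. Unset Printing Implicit Defensive.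
Import Order.TTheory GRing.Theory Num.Theory.
Import numFieldNormedType.Exports.
Local Open Scope classical_set_scope.
Local Open Scope ring_scope.

(* Time is 0-based: round t = 0,1,2,... corresponds to round t+1 of the paper.
   a t w : action played at round t in outcome w; Rew t w : observed reward. *)

Section Bandit.
Variables (R : realType) (A : finType) (Omega : Type).

Definition Npulls (a : nat -> Omega -> A) (t : nat) (x : A) (w : Omega) : nat :=
  \sum_(i < t | a i w == x) 1.

Definition rhat (a : nat -> Omega -> A) (Rew : nat -> Omega -> R)
    (t : nat) (x : A) (w : Omega) : R :=
  (\sum_(i < t | a i w == x) Rew i w) / (Npulls a t x w)%:R.

(* bonus b^t(x) = min(c1/N, c2/sqrt N), parameters in (0, +oo]; a parameter
   equal to +oo yields a term +oo, i.e. the term is absent from the min. *)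
Definition eqo_bonus (c1 c2 : \bar R) (n : nat) : \bar R :=
  Order.min (c1 * ((n%:R : R)^-1)%:E)%E (c2 * ((Num.sqrt (n%:R : R))^-1)%:E)%E.

Definition eqo_index (c1 c2 : nat -> \bar R) (a : nat -> Omega -> A)
    (Rew : nat -> Omega -> R) (t : nat) (x : A) (w : Omega) : \bar R :=
  ((rhat a Rew t x w)%:E + eqo_bonus (c1 t.+1) (c2 t.+1) (Npulls a t x w))%E.

(* The action sequence a is a run of Bandit EQO+ with input sequences
   (c1_t, c2_t) (paper-indexed t = 1,2,...): the first #|A| rounds play every
   arm exactly once, afterwards a_t maximizes the index (ties arbitrary). *)
Definition is_EQOplus_run (c1 c2 : nat -> \bar R) (a : nat -> Omega -> A)
    (Rew : nat -> Omega -> R) : Prop :=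
  forall w,
    (forall i j, (i < #|A|)%N -> (j < #|A|)%N -> a i w = a j w -> i = j) /\
    (forall t, (#|A| <= t)%N -> forall x : A,
        (eqo_index c1 c2 a Rew t x w <= eqo_index c1 c2 a Rew t (a t w) w)%E).

(* generators of the sigma-algebra sigma(F_{t-1}, a_t) (paper indexing):
   actions a_0..a_t and rewards R_0..R_{t-1} *)
Definition hist_gen (a : nat -> Omega -> A) (Rew : nat -> Omega -> R) (t : nat)
    : set (set Omega) :=
  [set B | exists i x, (i <= t)%N /\ B = a i @^-1` [set x]] `|`
  [set B | exists i (Y : set R), (i < t)%N /\ measurable Y /\ B = Rew i @^-1` Y].

Definition gap (r : A -> R) (astar : A) (x : A) : R := r astar - r x.

Definition regret (r : A -> R) (astar : A) (a : nat -> Omega -> A) (T : nat)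
    (w : Omega) : R := \sum_(t < T) gap r astar (a t w).

End Bandit.

Definition dist_regret (R : realType) (d : measure_display) (Omega : measurableType d)
    (P : probability Omega R) (Reg : Omega -> R) (delta : R) : \bar R :=
  ereal_inf [set x%:E | x in [set x : R | (P [set w | (x < Reg w)%R] <= delta%:E)%E]].

(* Main.v *)
Require Import Defs.
From HB Require Import structures.
From mathcomp Require Import all_boot all_order all_algebra.
From mathcomp Require Import all_classical all_reals all_analysis.
From mathcomp Require Import measurable_realfun lra ring.
Import Order.TTheory GRing.Theory Num.Theory.
Import numFieldNormedType.Exports.
Local Open Scope classical_set_scope.
Local Open Scope ring_scope.

(** Let [X_t] be the reward noise. Quasi-optimism: if the exponential martingale
    of [- lam1 X] on the optimal arm stays below [exp (lam1 c1)], then a chosen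
    arm [x] with [n] previous pulls and noise sum [S_n] satisfies
    [n (gap x - lam1 sigma^2 / 2) <= S_n + c1].
    Applied at the last pull of [x], this bounds [(N x - 1) gap x], and the sum of
    these bounds avoids the harmonic series of the bonuses. The last pull is not a
    stopping time, so [S_n] is bounded by the running maximum [Q x ^ 2] of the
    exponential martingale [L x] of [lam2 X] on arm [x]: the product over
    suboptimal arms of [Q x + L x / Q x] is a supermartingale starting at
    [2 ^ (#|A| - 1)] and dominating the product of the [Q x].

    A union bound over the two failure events is too weak for [delta] close to 1.
    Since each round moves only one of the two supermartingales, their failure
    probabilities combine as if independent, to [1 - (1 - p) (1 - q')]. With
    [p = delta (1 + delta) / 2] and
    [lam1 = ln (1 / p) / c1], [lam2 = ln (8 (1 + delta) / delta) / c1] one gets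
    [lam1 + lam2 = 2 ln (4 / delta) / c1] and total failure probability at most
    [delta]. *)

(** * Integration against a smaller sigma-algebra *)

Section SubSigmaAlgebra.
Context {d d' : measure_display} {X : measurableType d} {Y : measurableType d'}.
Context {R : realType}.
Variables (phi : X -> Y) (mu : {measure set X -> \bar R}).
Hypothesis mphi : measurable_fun [set: X] phi.
Local Open Scope ereal_scope.

Import HBNNSimple.

(* With [phi] the identity from a sigma-algebra to a smaller one, the hypothesis
   says that the conditional expectation of [g] is at most 1. *)
Lemma ge0_integral_mul_le (g : X -> R) (f : Y -> R) :
  (forall x, 0 <= g x)%R -> measurable_fun [set: X] g ->
  (forall B, measurable B ->
     \int[mu]_(x in phi @^-1` B) (g x)%:E <= mu (phi @^-1` B)) ->
  (forall y, 0 <= f y)%R -> measurable_fun [set: Y] f ->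
  \int[mu]_x (f (phi x) * g x)%:E <= \int[mu]_x (f (phi x))%:E.
Proof.
move=> g0 mg hg f0 mf.
have mfE : measurable_fun [set: Y] (EFin \o f) by exact/measurable_EFinP.
have fE0 y : [set: Y] y -> 0 <= (EFin \o f) y by move=> _; rewrite lee_fin.
pose h := nnsfun_approx measurableT mfE.
have mh n : measurable_fun [set: X] (h n \o phi).
  by apply: measurableT_comp => //; exact/measurable_funP.
have ndh n m y : (n <= m)%N -> (h n y <= h m y)%R.
  by move=> nm; exact/lefP/nd_nnsfun_approx.
have hcvg x : (fun n => (h n (phi x))%:E) @ \oo --> (f (phi x))%:E.
  exact: (cvg_nnsfun_approx measurableT mfE fE0).
have hle n y : (h n y <= f y)%R.
  rewrite -lee_fin.
  rewrite -(_ : limn (fun n => (h n y)%:E) = (f y)%:E); last first.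
    by apply/cvg_lim => //; exact: (cvg_nnsfun_approx measurableT mfE fE0).
  apply: lime_ge; last by exists n => // m /= nm; rewrite lee_fin ndh.
  by apply/cvg_ex; exists (f y)%:E; exact: (cvg_nnsfun_approx measurableT mfE fE0).
(* Monotone convergence reduces the claim to the simple functions [h n], whose level sets are then
   treated one by one with [hg]. *)
have -> : \int[mu]_x (f (phi x) * g x)%:E =
    limn (fun n => \int[mu]_x (h n (phi x) * g x)%:E).
  rewrite -monotone_convergence//; last 3 first.
  - by move=> n; apply/measurable_EFinP; exact: (measurable_funM (mh n) mg).
  - by move=> n x _; rewrite lee_fin mulr_ge0.
  - by move=> x _ a b ab; rewrite lee_fin ler_wpM2r// ndh.
  apply: eq_integral => x _; apply/esym/cvg_lim => //.
  rewrite EFinM; under eq_fun do rewrite EFinM.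
  by apply: cvgeZr => //; exact: hcvg.
have mhg n : measurable_fun [set: X] (fun x => (h n (phi x) * g x)%:E).
  by apply/measurable_EFinP; exact: (measurable_funM (mh n) mg).
apply: lime_le.
  apply: ereal_nondecreasing_is_cvgn => a b ab.
  apply: ge0_le_integral => //.
  - by move=> x _; rewrite lee_fin mulr_ge0.
  - by move=> x _; rewrite lee_fin ler_wpM2r// ndh.
apply: nearW => n.
apply: (@le_trans _ _ (\int[mu]_x (h n (phi x))%:E)); last first.
  apply: ge0_le_integral => //.
  - by move=> x _; rewrite lee_fin.
  - exact/measurable_EFinP/mh.
  - by apply/measurable_EFinP; exact: measurableT_comp.
  - by move=> x _; rewrite lee_fin.
have mpre r : measurable (phi @^-1` (h n @^-1` [set r])).
  by rewrite -(setTI (_ @^-1` _)); exact: mphi.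
have hphi x : (h n (phi x))%:E = \sum_(y \in range (h n))
    (y * \1_(phi @^-1` (h n @^-1` [set y])) x)%:E.
  by rewrite fimfunE -fsumEFin.
have nn y x : 0 <= (y * \1_(phi @^-1` (h n @^-1` [set y])) x)%:E.
  exact: (nnfun_muleindic_ge0 (h n) y (phi x)).
have mind y : measurable_fun [set: X]
    (fun x => (y * \1_(phi @^-1` (h n @^-1` [set y])) x)%:E).
  by apply/measurable_EFinP; apply: measurable_funM.
under [leRHS]eq_integral do rewrite hphi.
rewrite ge0_integral_fsum//.
under [leLHS]eq_integral do rewrite EFinM hphi ge0_mule_fsuml//.
rewrite ge0_integral_fsum//; last 2 first.
- by move=> y; apply: emeasurable_funM => //; exact/measurable_EFinP.
- by move=> y x _; apply: mule_ge0; [exact: nn|rewrite lee_fin].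
rewrite !fsbig_finite//=; apply: lee_sum => y _.
have [y0|y0] := leP 0%R y; last first.
  rewrite preimage_nnfun0//= preimage_set0.
  by rewrite !integral0_eq// => x _; rewrite indic0 mulr0 ?mul0e.
under [leRHS]eq_integral do rewrite EFinM.
under [leLHS]eq_integral do rewrite EFinM -muleA.
rewrite [leRHS]ge0_integralZl//; last exact/measurable_EFinP.
rewrite [leLHS]ge0_integralZl//; last 2 first.
- by apply: emeasurable_funM; exact/measurable_EFinP.
- by move=> x _; rewrite mule_ge0 ?lee_fin.
apply: lee_wpmul2l => //; rewrite integral_indic// setIT.
under eq_integral do rewrite muleC.
rewrite (eq_integral ((EFin \o g) \_ (phi @^-1` (h n @^-1` [set y])))).
  by rewrite -integral_mkcond; apply: hg.
by move=> x _; rewrite epatch_indic.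
Qed.

End SubSigmaAlgebra.

(** * Measurability along finite-valued maps *)

Lemma measurable_fun_finite_select {d d' : measure_display}
    {T : measurableType d} {T' : measurableType d'} {A : finType}
    (c : T -> A) (h : A -> T -> T') :
  (forall x, measurable (c @^-1` [set x])) ->
  (forall x, measurable_fun [set: T] (h x)) ->
  measurable_fun [set: T] (fun w => h (c w) w).
Proof.
move=> mc mh _ Y mY; rewrite setTI.
have -> : (fun w => h (c w) w) @^-1` Y =
    \big[setU/set0]_(x : A) (c @^-1` [set x] `&` h x @^-1` Y).
  rewrite -bigcup_seq; apply/seteqP; split=> [w Yw|w [x _ [/= <-]]//].
  by exists (c w); rewrite //= mem_index_enum.
apply: bigsetU_measurable => x _; apply: measurableI => //.
by rewrite -[X in measurable X]setTI; exact: mh.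
Qed.

Lemma measurable_fun_if_eq {d d' : measure_display}
    {T : measurableType d} {T' : measurableType d'} {A : finType}
    (c : T -> A) (x : A) (f g : T -> T') :
  (forall y, measurable (c @^-1` [set y])) ->
  measurable_fun [set: T] f -> measurable_fun [set: T] g ->
  measurable_fun [set: T] (fun w => if c w == x then f w else g w).
Proof.
move=> mc mf mg.
apply: (@measurable_fun_finite_select _ _ _ _ _ c
  (fun y w => if y == x then f w else g w)) => // y.
by case: (y == x).
Qed.

(** * Pathwise construction of the potential *)

Section Potential.
Context {R : realType} {A : finType} {Omega : Type}.
Variables (a : nat -> Omega -> A) (Rew : nat -> Omega -> R).
Variables (r : A -> R) (astar : A) (sigma lam1 lam2 p q : R).

Definition noise t w : R := Rew t w - r (a t w).

(** Low noise is harmful on the optimal arm, high noise on a suboptimal one; hence the opposite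
    signs. *)
Definition tilt x : R := if x == astar then - lam1 else lam2.

(** The subtracted term is the sub-Gaussian bound on the log moment generating function, so the
    exponential has conditional mean at most 1. *)
Definition log_factor x t w : R :=
  tilt x * noise t w - tilt x ^+ 2 * sigma ^+ 2 / 2.

Definition log_wealth t x w : R := \sum_(i < t | a i w == x) log_factor x i w.

(* [p] times the wealth of the optimal arm, frozen once it has reached 1. *)
Fixpoint frozen_wealth t w : R :=
  if t is s.+1 then
    if a s w == astar then
      if frozen_wealth s w < 1 then
        frozen_wealth s w * expR (log_factor astar s w)
      else frozen_wealth s w
    else frozen_wealth s w
  else p.

Definition root_wealth t x w : R := expR (log_wealth t x w / 2).

Fixpoint peak t x w : R :=
  if t is s.+1 then Num.max (peak s x w) (root_wealth s.+1 x w) else 1.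

(* At least [peak]; linear in the wealth [root_wealth ^+ 2] as long as the peak
   does not move, and by AM-GM no larger than this linear function if it does. *)
Definition arm_potential t x w : R :=
  peak t x w + root_wealth t x w ^+ 2 / peak t x w.

Definition arms_potential t w : R :=
  q * \prod_(x | x != astar) arm_potential t x w.

Definition optimal_risk t w : R := Num.min 1 (frozen_wealth t w).
Definition arms_risk t w : R := Num.min 1 (arms_potential t w).

(* Equals [1 - (1 - optimal_risk) (1 - arms_risk)]: only one of the two risks
   moves in each round, and [potential] is nondecreasing and affine in each. *)
Definition potential t w : R :=
  optimal_risk t w + (1 - optimal_risk t w) * arms_risk t w.

(* The share of [potential t] that is multiplied by the next noise factor. *)
Definition stake t w : R :=
  if a t w == astar then
    if frozen_wealth t w < 1 then (1 - arms_risk t w) * frozen_wealth t w else 0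
  else
    if arms_potential t w < 1 then
      (1 - optimal_risk t w) * arms_potential t w *
      (root_wealth t (a t w) w ^+ 2 /
        (peak t (a t w) w ^+ 2 + root_wealth t (a t w) w ^+ 2))
    else 0.

Hypotheses (p_ge0 : 0 <= p) (q_ge0 : 0 <= q).

Lemma log_wealthS t x w : log_wealth t.+1 x w =
  log_wealth t x w + (if a t w == x then log_factor x t w else 0).
Proof. by rewrite /log_wealth big_mkcond big_ord_recr/= -big_mkcond. Qed.

Lemma frozen_wealth_ge0 t w : 0 <= frozen_wealth t w.
Proof.
elim: t => [//|t IH] /=; case: ifP => // _; case: ifP => // _.
by rewrite mulr_ge0// expR_ge0.
Qed.

(** Freezing makes the crossing of level 1 permanent, so the value at the horizon controls all
    earlier times. *)
Lemma frozen_wealth_ge1 s t w : (s <= t)%N ->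
  1 <= frozen_wealth s w -> 1 <= frozen_wealth t w.
Proof.
move=> /subnK <-; elim: (t - s)%N => [//|k IH] /= /IH u1.
by case: ifP => // _; rewrite ltNge u1.
Qed.

Lemma frozen_wealthE t w : frozen_wealth t w < 1 ->
  frozen_wealth t w = p * expR (log_wealth t astar w).
Proof.
elim: t => [_|t IH]; first by rewrite /log_wealth big_ord0 expR0 mulr1.
rewrite log_wealthS/=; case: ifP => [_|_ /IH ->]; last by rewrite addr0.
have [u1 _|u1] := ltP (frozen_wealth t w) 1; last by rewrite ltNge u1.
by rewrite IH// expRD mulrA.
Qed.

Lemma root_wealth_gt0 t x w : 0 < root_wealth t x w.
Proof. exact: expR_gt0. Qed.

Lemma peak_ge1 t x w : 1 <= peak t x w.
Proof. by elim: t => [//|t IH] /=; rewrite le_max IH. Qed.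

Lemma peak_gt0 t x w : 0 < peak t x w.
Proof. exact: lt_le_trans ltr01 (peak_ge1 t x w). Qed.

Lemma root_wealth_le_peak s t x w : (s <= t)%N ->
  root_wealth s x w <= peak t x w.
Proof.
elim: t => [|t IH] in s *; rewrite ?leqn0 /=.
  by move=> /eqP ->; rewrite /root_wealth /log_wealth big_ord0 mul0r expR0.
rewrite leq_eqVlt ltnS => /predU1P[->|/IH h]; first by rewrite le_max lexx orbT.
by rewrite le_max h.
Qed.

Lemma peak_le_arm_potential t x w : peak t x w <= arm_potential t x w.
Proof. by rewrite lerDl divr_ge0 ?sqr_ge0// ltW// peak_gt0. Qed.

Lemma arm_potential_gt0 t x w : 0 < arm_potential t x w.
Proof. exact: lt_le_trans (peak_gt0 t x w) (peak_le_arm_potential t x w). Qed.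

Lemma root_wealthS_other t x w : a t w != x ->
  root_wealth t.+1 x w = root_wealth t x w.
Proof. by move=> /negbTE ax; rewrite /root_wealth log_wealthS ax addr0. Qed.

Lemma arm_potentialS_other t x w : a t w != x ->
  arm_potential t.+1 x w = arm_potential t x w.
Proof.
move=> ax; have pE : peak t.+1 x w = peak t x w.
  by rewrite /= root_wealthS_other// max_l// root_wealth_le_peak.
by rewrite /arm_potential pE root_wealthS_other.
Qed.

Lemma arm_potentialS t w : arm_potential t.+1 (a t w) w <=
  peak t (a t w) w + root_wealth t (a t w) w ^+ 2 / peak t (a t w) w *
                     expR (log_factor (a t w) t w).
Proof.
set x := a t w; have Q0 := peak_gt0 t x w.
have -> : root_wealth t x w ^+ 2 / peak t x w * expR (log_factor x t w) =
    root_wealth t.+1 x w ^+ 2 / peak t x w.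
  rewrite mulrAC; congr (_ / _); rewrite /root_wealth -!expRM_natl -expRD.
  by rewrite log_wealthS eqxx; congr expR; field.
rewrite /arm_potential [peak t.+1 x w]/= -/(root_wealth t.+1 x w).
(* Without a new peak the two sides agree; at a new peak [z] both terms equal [z], and the
   difference is a square over [Q]. *)
have [//|lt_peak] := leP (root_wealth t.+1 x w) (peak t x w).
have z0 := root_wealth_gt0 t.+1 x w.
move: Q0 z0 lt_peak; move: (peak t x w) (root_wealth t.+1 x w) => Q z Q0 z0 _.
rewrite expr2 mulfK ?gt_eqF// -subr_ge0.
have -> : Q + z * z / Q - (z + z) = (Q - z) ^+ 2 / Q by field; rewrite gt_eqF.
by rewrite divr_ge0 ?sqr_ge0// ltW.
Qed.

Lemma arms_potential_ge0 t w : 0 <= arms_potential t w.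
Proof. by rewrite mulr_ge0// prodr_ge0// => x _; exact/ltW/arm_potential_gt0. Qed.

Lemma arms_potentialS_other t w : a t w = astar ->
  arms_potential t.+1 w = arms_potential t w.
Proof.
move=> at_; congr (_ * _); apply: eq_bigr => x xa.
by rewrite arm_potentialS_other// at_ eq_sym.
Qed.

Lemma optimal_risk_ge0 t w : 0 <= optimal_risk t w.
Proof. by rewrite le_min ler01 frozen_wealth_ge0. Qed.

Lemma optimal_risk_le1 t w : optimal_risk t w <= 1.
Proof. by rewrite ge_min lexx. Qed.

Lemma arms_risk_ge0 t w : 0 <= arms_risk t w.
Proof. by rewrite le_min ler01 arms_potential_ge0. Qed.

Lemma arms_risk_le1 t w : arms_risk t w <= 1.
Proof. by rewrite ge_min lexx. Qed.

Lemma potential_ge0 t w : 0 <= potential t w.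
Proof.
rewrite addr_ge0 ?optimal_risk_ge0// mulr_ge0 ?arms_risk_ge0//.
by rewrite subr_ge0 optimal_risk_le1.
Qed.

Lemma potential_le1 t w : potential t w <= 1.
Proof.
have := optimal_risk_le1 t w; have := arms_risk_le1 t w.
by rewrite /potential; nra.
Qed.

Lemma stake_ge0 t w : 0 <= stake t w.
Proof.
rewrite /stake; case: ifP => _; case: ifP => // _.
  by rewrite mulr_ge0 ?frozen_wealth_ge0// subr_ge0 arms_risk_le1.
rewrite mulr_ge0//.
  by rewrite mulr_ge0 ?arms_potential_ge0// subr_ge0 optimal_risk_le1.
by rewrite divr_ge0 ?addr_ge0 ?sqr_ge0.
Qed.

(** This keeps [potential - stake] nonnegative, so that expectations can be split without
    integrability arguments. *)
Lemma stake_le_potential t w : stake t w <= potential t w.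
Proof.
rewrite /stake; case: ifP => _; case: ifP => [lt1|_]; rewrite ?potential_ge0//.
  have -> : frozen_wealth t w = optimal_risk t w by rewrite /optimal_risk min_r// ltW.
  by have := optimal_risk_ge0 t w; have := arms_risk_ge0 t w; rewrite /potential; lra.
have -> : arms_potential t w = arms_risk t w by rewrite /arms_risk min_r// ltW.
apply: (@le_trans _ _ ((1 - optimal_risk t w) * arms_risk t w)).
  2: by rewrite lerDr optimal_risk_ge0.
apply: ler_piMr; first by rewrite mulr_ge0 ?arms_risk_ge0// subr_ge0 optimal_risk_le1.
rewrite ler_pdivrMr ?mul1r ?lerDr ?sqr_ge0//.
by rewrite ltr_wpDl ?sqr_ge0// exprn_gt0// root_wealth_gt0.
Qed.

(** Only one risk moves. While its process is below 1, its new value is bounded by an affine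
    function of the noise factor; otherwise the potential is already 1 and the stake is 0. *)
Lemma potentialS t w : potential t.+1 w <=
  (potential t w - stake t w) + stake t w * expR (log_factor (a t w) t w).
Proof.
have U0 := optimal_risk_ge0 t w; have U1 := optimal_risk_le1 t w.
have V0 := arms_risk_ge0 t w; have V1 := arms_risk_le1 t w.
rewrite /stake; have [at_|ant] := eqVneq (a t w) astar.
  have VE : arms_risk t.+1 w = arms_risk t w by rewrite /arms_risk arms_potentialS_other.
  have [u1|u1] := ltP (frozen_wealth t w) 1; last first.
    have UE : optimal_risk t w = 1 by rewrite /optimal_risk min_l.
    rewrite subr0 mul0r addr0 [potential t w]/potential UE subrr mul0r addr0.
    exact: potential_le1.
  have UE : optimal_risk t w = frozen_wealth t w by rewrite /optimal_risk min_r// ltW.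
  have : optimal_risk t.+1 w <= frozen_wealth t w * expR (log_factor astar t w).
    by rewrite /optimal_risk /= at_ eqxx u1 ge_min lexx orbT.
  rewrite /potential VE UE at_.
  move: (optimal_risk t.+1 w) (frozen_wealth t w) (expR _) (arms_risk t w) V0 V1.
  by move=> U' u e v v0 v1 le_U'; nra.
have fE : frozen_wealth t.+1 w = frozen_wealth t w by rewrite /= (negbTE ant).
have UE : optimal_risk t.+1 w = optimal_risk t w by rewrite /optimal_risk fE.
have [v1|v1] := ltP (arms_potential t w) 1; last first.
  have VE : arms_risk t w = 1 by rewrite /arms_risk min_l.
  rewrite subr0 mul0r addr0 [potential t w]/potential VE mulr1 addrC subrK.
  exact: potential_le1.
have VE : arms_risk t w = arms_potential t w by rewrite /arms_risk min_r// ltW.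
set x := a t w in ant *; set Q := peak t x w; set z := root_wealth t x w.
set e := expR _.
have Q0 : 0 < Q := peak_gt0 t x w.
have z0 : 0 < z := root_wealth_gt0 t x w.
pose rest := q * \prod_(y | (y != astar) && (y != x)) arm_potential t y w.
have rest0 : 0 <= rest.
  by rewrite mulr_ge0// prodr_ge0// => y _; exact/ltW/arm_potential_gt0.
have aE : arms_potential t w = rest * (Q + z ^+ 2 / Q).
  rewrite /arms_potential (bigD1 x)//= [arm_potential t x w]/arm_potential.
  by rewrite /rest mulrA mulrAC.
have aSE : arms_potential t.+1 w <= rest * (Q + z ^+ 2 / Q * e).
  rewrite /arms_potential (bigD1 x)//= mulrCA mulrC.
  rewrite (eq_bigr (fun y => arm_potential t y w)); last first.
    by move=> y /andP[_ yx]; rewrite arm_potentialS_other// eq_sym.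
  by rewrite -/rest ler_wpM2l// arm_potentialS.
have VS : arms_risk t.+1 w <= rest * (Q + z ^+ 2 / Q * e).
  by apply: le_trans aSE; rewrite ge_min lexx orbT.
(* The fraction in [stake] extracts from [Q + z ^+ 2 / Q] its second term, the only one multiplied
   by the noise factor. *)
have sE : arms_potential t w * (z ^+ 2 / (Q ^+ 2 + z ^+ 2)) = rest * (z ^+ 2 / Q).
  by rewrite aE; field; rewrite !gt_eqF// addr_gt0 ?exprn_gt0.
rewrite -mulrA sE /potential UE VE aE.
move: (z ^+ 2 / Q) VS => k VS.
have : (1 - optimal_risk t w) * arms_risk t.+1 w <=
    (1 - optimal_risk t w) * (rest * (Q + k * e)).
  by rewrite ler_wpM2l// subr_ge0.
by move: (optimal_risk t w) => u; lra.
Qed.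

End Potential.

(** * Measurability of the potential and the stake *)

Section Measurability.
Context {R : realType} {A : finType} {d : measure_display}.
Context {T : measurableType d}.
Variables (a : nat -> T -> A) (Rew : nat -> T -> R).
Variables (r : A -> R) (astar : A) (sigma lam1 lam2 p q : R).

Lemma measurable_inv_ge0 (f : T -> R) : (forall w, 0 <= f w) ->
  measurable_fun [set: T] f -> measurable_fun [set: T] (fun w => (f w)^-1).
Proof.
move=> f0 mf; rewrite (_ : (fun w => _) = (fun w => f w `^ (-1))); last first.
  by apply/funext => w; rewrite powR_inv1.
exact: (measurableT_comp (measurable_powR (-1)) mf).
Qed.

Lemma measurable_noise t :
  (forall x, measurable (a t @^-1` [set x])) ->
  measurable_fun [set: T] (Rew t) ->
  measurable_fun [set: T] (noise a Rew r t).
Proof.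
move=> ma mR.
apply: (@measurable_fun_finite_select _ _ _ _ _ (a t)
  (fun x w => Rew t w - r x)) => // x.
exact: measurable_funB.
Qed.

Lemma measurable_log_factor x t :
  (forall y, measurable (a t @^-1` [set y])) ->
  measurable_fun [set: T] (Rew t) ->
  measurable_fun [set: T] (log_factor a Rew r astar sigma lam1 lam2 x t).
Proof.
move=> ma mR; apply: measurable_funB => //; apply: measurable_funM => //.
exact: measurable_noise.
Qed.

Variable n : nat.
Hypothesis ma : forall i x, (i < n)%N -> measurable (a i @^-1` [set x]).
Hypothesis mRew : forall i, (i < n)%N -> measurable_fun [set: T] (Rew i).

Lemma measurable_log_wealth t x : (t <= n)%N ->
  measurable_fun [set: T] (log_wealth a Rew r astar sigma lam1 lam2 t x).
Proof.
elim: t => [_|t IH tn].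
  rewrite (_ : log_wealth _ _ _ _ _ _ _ _ _ = cst 0) //.
  by apply/funext => w; rewrite /log_wealth big_ord0.
rewrite (_ : log_wealth _ _ _ _ _ _ _ _ _ =
  log_wealth a Rew r astar sigma lam1 lam2 t x \+
  (fun w => if a t w == x then log_factor a Rew r astar sigma lam1 lam2 x t w
            else 0)); last by apply/funext => w; rewrite log_wealthS.
apply: measurable_funD; first exact/IH/ltnW.
apply: measurable_fun_if_eq => [y| |//]; first exact: ma.
by apply: measurable_log_factor => [y|]; [exact: ma|exact: mRew].
Qed.

Lemma measurable_frozen_wealth t : (t <= n)%N ->
  measurable_fun [set: T] (frozen_wealth a Rew r astar sigma lam1 lam2 p t).
Proof.
elim: t => [_|t IH tn]; first exact: measurable_cst.
have mt := IH (ltnW tn).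
apply: measurable_fun_if_eq => //; first by move=> y; exact: ma.
apply: measurable_fun_ifT => //; first exact: measurable_fun_ltr.
apply: measurable_funM => //; apply: measurableT_comp => //.
by apply: measurable_log_factor => [y|]; [exact: ma|exact: mRew].
Qed.

Lemma measurable_root_wealth t x : (t <= n)%N ->
  measurable_fun [set: T] (root_wealth a Rew r astar sigma lam1 lam2 t x).
Proof.
move=> tn; apply: measurableT_comp => //; apply: measurable_funM => //.
exact: measurable_log_wealth.
Qed.

Lemma measurable_peak t x : (t <= n)%N ->
  measurable_fun [set: T] (peak a Rew r astar sigma lam1 lam2 t x).
Proof.
elim: t => [_|t IH tn]; first exact: measurable_cst.
apply: measurable_maxr; first exact/IH/ltnW.
exact: measurable_root_wealth.
Qed.

Lemma measurable_arm_potential t x : (t <= n)%N ->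
  measurable_fun [set: T] (arm_potential a Rew r astar sigma lam1 lam2 t x).
Proof.
move=> tn; apply: measurable_funD; first exact: measurable_peak.
apply: measurable_funM; first exact/measurable_funX/measurable_root_wealth.
by apply: measurable_inv_ge0 => [w|]; [exact/ltW/peak_gt0|exact: measurable_peak].
Qed.

Lemma measurable_arms_potential t : (t <= n)%N ->
  measurable_fun [set: T] (arms_potential a Rew r astar sigma lam1 lam2 q t).
Proof.
move=> tn; apply: measurable_funM => //.
under eq_fun do rewrite -big_filter.
by apply: measurable_prod => x _; exact: measurable_arm_potential.
Qed.

Lemma measurable_optimal_risk t : (t <= n)%N ->
  measurable_fun [set: T] (optimal_risk a Rew r astar sigma lam1 lam2 p t).
Proof.
by move=> tn; apply: measurable_minr => //; exact: measurable_frozen_wealth.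
Qed.

Lemma measurable_arms_risk t : (t <= n)%N ->
  measurable_fun [set: T] (arms_risk a Rew r astar sigma lam1 lam2 q t).
Proof.
by move=> tn; apply: measurable_minr => //; exact: measurable_arms_potential.
Qed.

Lemma measurable_potential t : (t <= n)%N ->
  measurable_fun [set: T] (potential a Rew r astar sigma lam1 lam2 p q t).
Proof.
move=> tn; have mU := measurable_optimal_risk _ tn; have mV := measurable_arms_risk _ tn.
by apply: measurable_funD => //; apply: measurable_funM => //; exact: measurable_funB.
Qed.

(** Rewards are assumed measurable only before round [n], but the action also at round [n]: the
    statement thus covers both the ambient sigma-algebra and the history, where it says that the
    stake is predictable. *)
Lemma measurable_stake :
  (forall x, measurable (a n @^-1` [set x])) ->
  measurable_fun [set: T] (stake a Rew r astar sigma lam1 lam2 p q n).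
Proof.
move=> man; have mU := measurable_optimal_risk _ (leqnn n).
have mV := measurable_arms_risk _ (leqnn n).
have mf := measurable_frozen_wealth _ (leqnn n).
have mp := measurable_arms_potential _ (leqnn n).
have mz x := measurable_root_wealth _ x (leqnn n).
have mQ x := measurable_peak _ x (leqnn n).
apply: (@measurable_fun_finite_select _ _ _ _ _ (a n) (fun x w =>
  if x == astar then
    if frozen_wealth a Rew r astar sigma lam1 lam2 p n w < 1 then
      (1 - arms_risk a Rew r astar sigma lam1 lam2 q n w) *
      frozen_wealth a Rew r astar sigma lam1 lam2 p n w else 0
  else
    if arms_potential a Rew r astar sigma lam1 lam2 q n w < 1 then
      (1 - optimal_risk a Rew r astar sigma lam1 lam2 p n w) *
      arms_potential a Rew r astar sigma lam1 lam2 q n w *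
      (root_wealth a Rew r astar sigma lam1 lam2 n x w ^+ 2 /
        (peak a Rew r astar sigma lam1 lam2 n x w ^+ 2 +
         root_wealth a Rew r astar sigma lam1 lam2 n x w ^+ 2))
    else 0)) => // x.
case: (x == astar); apply: measurable_fun_ifT => //;
  do ?exact: measurable_fun_ltr.
  by apply: measurable_funM => //; exact: measurable_funB.
apply: measurable_funM.
  by apply: measurable_funM => //; exact: measurable_funB.
apply: measurable_funM; first exact: measurable_funX.
apply: measurable_inv_ge0 => [w|]; first by rewrite addr_ge0 ?sqr_ge0.
by apply: measurable_funD; exact: measurable_funX.
Qed.

End Measurability.

(** * Supermartingale property and maximal inequality *)

Section Expectation.
Context {R : realType} {A : finType} {d : measure_display}.
Context {Omega : measurableType d} (P : probability Omega R).
Variables (a : nat -> Omega -> A) (Rew : nat -> Omega -> R).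
Variables (r : A -> R) (astar : A) (sigma lam1 lam2 p q : R).
Hypotheses (p_ge0 : 0 <= p) (q_ge0 : 0 <= q).
Hypothesis ma : forall t x, measurable (a t @^-1` [set x]).
Hypothesis mRew : forall t, measurable_fun [set: Omega] (Rew t).
Hypothesis subgauss : forall t B (lam : R), <<s hist_gen a Rew t>> B ->
  (\int[P]_(w in B) (expR (lam * (Rew t w - r (a t w))))%:E
     <= (expR (lam ^+ 2 * sigma ^+ 2 / 2))%:E * P B)%E.

Let factor t w := expR (log_factor a Rew r astar sigma lam1 lam2 (a t w) t w).

Lemma measurable_hist t B : <<s hist_gen a Rew t>> B -> measurable B.
Proof.
apply: smallest_sub; first exact: sigma_algebra_measurable.
move=> C [[i [x [_ ->]]]|[i [Y [_ [mY ->]]]]]; first exact: ma.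
by rewrite -[X in measurable X]setTI; exact: mRew.
Qed.

Lemma hist_action t i x : (i <= t)%N -> <<s hist_gen a Rew t>> (a i @^-1` [set x]).
Proof. by move=> it; apply: sub_sigma_algebra; left; exists i, x. Qed.

Lemma hist_reward t i (Y : set R) : (i < t)%N -> measurable Y ->
  <<s hist_gen a Rew t>> (Rew i @^-1` Y).
Proof. by move=> it mY; apply: sub_sigma_algebra; right; exists i, Y. Qed.

Lemma measurable_factor t : measurable_fun [set: Omega] (factor t).
Proof.
apply: (@measurable_fun_finite_select _ _ _ _ _ (a t) (fun x w =>
  expR (log_factor a Rew r astar sigma lam1 lam2 x t w))) => // x.
by apply: measurableT_comp => //; exact: measurable_log_factor.
Qed.

Lemma integral_factor_le_on t x B : <<s hist_gen a Rew t>> B ->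
  (\int[P]_(w in B) (expR (log_factor a Rew r astar sigma lam1 lam2 x t w))%:E
     <= P B)%E.
Proof.
move=> hB; have mB := measurable_hist _ _ hB.
set l := tilt astar lam1 lam2 x.
under eq_integral do rewrite /log_factor addrC expRD EFinM.
have mn : measurable_fun B (fun w => (expR (l * noise a Rew r t w))%:E).
  apply: measurable_funTS; apply/measurable_EFinP; apply: measurableT_comp => //.
  by apply: measurable_funM => //; exact: measurable_noise.
rewrite ge0_integralZl//.
apply: (le_trans (lee_wpmul2l _ (subgauss _ _ l hB))).
  by rewrite lee_fin expR_ge0.
by rewrite muleA -EFinM -expRD addNr expR0 mul1e.
Qed.

(** The tilt depends on the played arm, but the history contains the current action, so [B] is cut
    into pieces on which the tilt is constant. *)
Lemma integral_factor_le t B : <<s hist_gen a Rew t>> B ->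
  (\int[P]_(w in B) (factor t w)%:E <= P B)%E.
Proof.
move=> hB; have mB := measurable_hist _ _ hB.
have BE : B = \big[setU/set0]_(x : A) (B `&` a t @^-1` [set x]).
  rewrite -bigcup_seq; apply/seteqP; split=> [w Bw|w [x _ []]//].
  by exists (a t w); rewrite //= mem_index_enum.
have hx x : <<s hist_gen a Rew t>> (B `&` a t @^-1` [set x]).
  have := @measurableI _ (g_sigma_algebraType (hist_gen a Rew t)) B
    (a t @^-1` [set x]).
  by apply => //; exact: hist_action.
have tr : trivIset [set: A] (fun x => B `&` a t @^-1` [set x]).
  by move=> x y _ _ [w [[_ /= <-] [_ /= <-]]].
have mx x : measurable (B `&` a t @^-1` [set x]) by exact: measurable_hist (hx x).
have splitB (f : Omega -> R) : (forall w, 0 <= f w) ->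
    measurable_fun [set: Omega] f -> (\int[P]_(w in B) (f w)%:E =
      \sum_(x : A) \int[P]_(w in B `&` a t @^-1` [set x]) (f w)%:E)%E.
  move=> f0 mf; rewrite {1}BE ge0_integral_bigsetU//.
  - exact: index_enum_uniq.
  - exact: sub_trivIset tr.
  - exact/measurable_EFinP/measurable_funTS.
  - by move=> w _; rewrite lee_fin.
rewrite splitB; [|by move=> w; exact: expR_ge0|exact: measurable_factor].
have -> : P B = (\int[P]_(w in B) ((fun=> 1 : R) w)%:E)%E.
  by rewrite integral_cst// mul1e.
rewrite splitB//; apply: lee_sum => x _; rewrite integral_cst// mul1e.
apply: le_trans (integral_factor_le_on t x _ (hx x)).
rewrite le_eqVlt; apply/orP; left; apply/eqP/eq_integral => w.
by rewrite inE => -[_ /= <-].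
Qed.

(** The stake is determined by the history and the current action, so multiplying it by the noise
    factor does not raise its mean. *)
Lemma expectation_potentialS t :
  (\int[P]_w (potential a Rew r astar sigma lam1 lam2 p q t.+1 w)%:E <=
   \int[P]_w (potential a Rew r astar sigma lam1 lam2 p q t w)%:E)%E.
Proof.
set Y := potential a Rew r astar sigma lam1 lam2 p q.
set b := stake a Rew r astar sigma lam1 lam2 p q t.
have mY s : measurable_fun [set: Omega] (Y s).
  by apply: (@measurable_potential _ _ _ _ _ _ _ _ _ _ _ _ _ s) => // *; exact: ma.
have mb : measurable_fun [set: Omega] b.
  by apply: measurable_stake => // *; exact: ma.
have mf := measurable_factor t.
have b0 w : 0 <= b w by exact: stake_ge0.
have bY w : b w <= Y t w by exact: stake_le_potential.
have mD : measurable_fun [set: Omega] (fun w => (Y t w - b w)%:E).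
  by apply/measurable_EFinP; exact: measurable_funB.
have mM : measurable_fun [set: Omega] (fun w => (b w * factor t w)%:E).
  by apply/measurable_EFinP; exact: measurable_funM.
have mbE : measurable_fun [set: Omega] (fun w => (b w)%:E) by exact/measurable_EFinP.
apply: (@le_trans _ _ (\int[P]_w ((Y t w - b w)%:E + (b w * factor t w)%:E))%E).
  apply: ge0_le_integral => //.
  - by move=> w _; rewrite lee_fin; exact: potential_ge0.
  - exact/measurable_EFinP.
  - exact: emeasurable_funD.
  - by move=> w _; rewrite -EFinD lee_fin; exact: potentialS.
have M0 w : (0 <= (b w * factor t w)%:E)%E by rewrite lee_fin mulr_ge0 ?expR_ge0.
have D0 w : (0 <= (Y t w - b w)%:E)%E by rewrite lee_fin subr_ge0.
rewrite ge0_integralD//.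
have -> : (\int[P]_w (Y t w)%:E =
    \int[P]_w (Y t w - b w)%:E + \int[P]_w (b w)%:E)%E.
  rewrite -ge0_integralD//; last by move=> w _; rewrite lee_fin.
  by apply: eq_integral => w _; rewrite -EFinD subrK.
rewrite leeD2l//.
pose G := g_sigma_algebraType (hist_gen a Rew t).
apply: (@ge0_integral_mul_le _ _ Omega G R idfun P _ (factor t) b) => //.
- by move=> _ B hB; rewrite setTI; exact: measurable_hist hB.
- by move=> w; exact: expR_ge0.
- by move=> B hB; exact: integral_factor_le.
- apply: (@measurable_stake _ _ _ G).
  + by move=> i x it; exact: hist_action (ltnW it).
  + by move=> i it _ B mB; rewrite setTI; exact: hist_reward.
  + by move=> x; exact: hist_action.
Qed.

Hypothesis p_le1 : p <= 1.

Lemma expectation_potential_le t :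
  (\int[P]_w (potential a Rew r astar sigma lam1 lam2 p q t w)%:E <=
   (p + (1 - p) * (q * 2 ^+ #|A|.-1))%:E)%E.
Proof.
elim: t => [|t IH]; last exact: le_trans (expectation_potentialS t) IH.
set c := p + _.
(* Before any play each arm potential is [1 + 1], and there are [#|A|.-1] suboptimal arms. *)
have potential0 w : potential a Rew r astar sigma lam1 lam2 p q 0 w <= c.
  rewrite /potential {1 2}/optimal_risk /= min_r// lerD2l ler_wpM2l ?subr_ge0//.
  rewrite ge_min; apply/orP; right; rewrite /arms_potential.
  rewrite (eq_bigr (fun=> 2)) => [|x _].
    by rewrite prodr_const cardC1.
  by rewrite /arm_potential /root_wealth /log_wealth /= big_ord0 mul0r expR0; lra.
apply: (@le_trans _ _ (\int[P]_w (cst c%:E) w)%E); last first.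
  rewrite integral_cst// [X in (_ * X)%E](_ : _ = 1%E) ?mule1//.
  exact: probability_setT.
apply: ge0_le_integral => //.
- by move=> w _; rewrite lee_fin; exact: potential_ge0.
- apply/measurable_EFinP.
  by apply: (@measurable_potential _ _ _ _ _ _ _ _ _ _ _ _ _ 0%N) => // *; exact: ma.
- by move=> w _; rewrite lee_fin.
Qed.

(** Markov's inequality at level 1. *)
Lemma probability_potential_le t (E : set Omega) : measurable E ->
  (forall w, E w -> 1 <= potential a Rew r astar sigma lam1 lam2 p q t w) ->
  (P E <= (p + (1 - p) * (q * 2 ^+ #|A|.-1))%:E)%E.
Proof.
move=> mE hE; apply: le_trans (expectation_potential_le t).
have -> : P E = (\int[P]_w (\1_E w)%:E)%E by rewrite integral_indic// setIT.
apply: ge0_le_integral => //.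
- exact/measurable_EFinP.
- apply/measurable_EFinP.
  by apply: (@measurable_potential _ _ _ _ _ _ _ _ _ _ _ _ _ t) => // *; exact: ma.
- move=> w _; rewrite lee_fin indicE; case: (boolP (w \in E)) => [|_].
    by rewrite inE => /hE.
  exact: potential_ge0.
Qed.

End Expectation.

(** * Deterministic analysis of one run *)

Section Run.
Context {R : realType} {A : finType} {Omega : Type}.
Variables (a : nat -> Omega -> A) (Rew : nat -> Omega -> R).
Variables (r : A -> R) (astar : A) (sigma lam1 lam2 p c1 : R).
Variables (w : Omega) (T : nat).

Local Notation N t x := (Npulls a t x w).

Let S t x : R := \sum_(i < t | a i w == x) noise a Rew r i w.

Lemma NpullsS t x : N t.+1 x = (N t x + (a t w == x))%N.
Proof.
rewrite /Npulls big_mkcond big_ord_recr/= -big_mkcond.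
by case: (a t w == x).
Qed.

Lemma sum_Npulls t : (\sum_(x : A) N t x = t)%N.
Proof.
by rewrite -[RHS]card_ord -sum1_card (partition_big (fun i : 'I_t => a i w) predT).
Qed.

Lemma log_wealth_noise t x :
  log_wealth a Rew r astar sigma lam1 lam2 t x w =
  tilt astar lam1 lam2 x * S t x -
  (N t x)%:R * (tilt astar lam1 lam2 x ^+ 2 * sigma ^+ 2 / 2).
Proof.
rewrite /log_wealth /log_factor big_split/= -mulr_sumr; congr (_ + _).
by rewrite sumrN /Npulls natr_sum mulr_suml; under [in RHS]eq_bigr do rewrite mul1r.
Qed.

Lemma rhat_noise t x : (0 < N t x)%N ->
  rhat a Rew t x w = r x + S t x / (N t x)%:R.
Proof.
move=> N0; have N0' : (N t x)%:R != 0 :> R by rewrite pnatr_eq0 -lt0n.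
have -> : S t x = \sum_(i < t | a i w == x) Rew i w - (N t x)%:R * r x.
  rewrite /S /Npulls natr_sum mulr_suml -sumrB.
  by apply: eq_bigr => i /eqP ai; rewrite /noise ai mul1r.
by rewrite /rhat; field.
Qed.

Lemma eqo_indexE t x : (0 < N t x)%N ->
  eqo_index (fun=> c1%:E) (fun=> +oo%E) a Rew t x w =
  (r x + (S t x + c1) / (N t x)%:R)%:E.
Proof.
(* Positivity of the count matters: as [0^-1 = 0], the absent term would otherwise be
   [+oo * 0 = 0]. *)
move=> N0; rewrite /eqo_index /eqo_bonus rhat_noise// gt0_mulye; last first.
  by rewrite lte_fin invr_gt0 sqrtr_gt0 ltr0n.
by rewrite min_l ?leey// -EFinM -EFinD -addrA -mulrDl.
Qed.

Hypothesis run : is_EQOplus_run (fun=> c1%:E) (fun=> +oo%E) a Rew.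

Lemma Npulls_gt0 t x : (#|A| <= t)%N -> (0 < N t x)%N.
Proof.
move=> At; have [inj_a _] := run w.
have inj : injective (fun i : 'I_#|A| => a i w).
  by move=> i j /(inj_a i j (ltn_ord i) (ltn_ord j)); exact: val_inj.
have /codomP[i xi] : x \in codom (fun i : 'I_#|A| => a i w).
  by apply: inj_card_onto => //; rewrite card_ord.
rewrite /Npulls sum1_card; apply/card_gt0P.
by exists (widen_ord At i); apply/eqP; rewrite xi.
Qed.

Lemma first_pull t : (t < #|A|)%N -> N t (a t w) = 0%N.
Proof.
move=> tA; have [inj_a _] := run w; rewrite /Npulls big_pred0// => i.
apply/negP => /eqP ai; have := ltn_ord i.
by rewrite (inj_a _ _ (ltn_trans (ltn_ord i) tA) tA ai) ltnn.
Qed.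

Hypotheses (lam1_gt0 : 0 < lam1) (lam2_gt0 : 0 < lam2) (c1_gt0 : 0 < c1).
Hypothesis pE : p = expR (- (lam1 * c1)).
Hypothesis low_frozen : frozen_wealth a Rew r astar sigma lam1 lam2 p T w < 1.

Lemma optimal_arm_noise t : (t <= T)%N ->
  - S t astar <= (N t astar)%:R * (lam1 * sigma ^+ 2 / 2) + c1.
Proof.
move=> tT.
have : frozen_wealth a Rew r astar sigma lam1 lam2 p t w < 1.
  rewrite ltNge; apply/negP => ge1; have := frozen_wealth_ge1 _ _ _ _ _ _ _ _ _ _ _ tT ge1.
  by rewrite leNgt low_frozen.
move=> lt1; have := lt1; rewrite frozen_wealthE// pE -expRD expR_lt1.
rewrite log_wealth_noise /tilt eqxx => h.
rewrite -(ler_pM2l lam1_gt0); nra.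
Qed.

Lemma chosen_arm_noise t : (t <= T)%N -> (#|A| <= t)%N ->
  (N t (a t w))%:R * (gap r astar (a t w) - lam1 * sigma ^+ 2 / 2) <=
  S t (a t w) + c1.
Proof.
move=> tT At; have [_ /(_ t At astar)] := run w.
have n0 := Npulls_gt0 t (a t w) At; have m0 := Npulls_gt0 t astar At.
rewrite !eqo_indexE// lee_fin; have := optimal_arm_noise t tT.
rewrite /gap; move: (S t (a t w)) (S t astar) => s u.
have {}n0 : 0 < (N t (a t w))%:R :> R by rewrite ltr0n.
have {}m0 : 0 < (N t astar)%:R :> R by rewrite ltr0n.
move: (N t (a t w))%:R n0 (N t astar)%:R m0 => n n0 m m0.
move=> hu hidx.
(* The bonus [c1 / m] of the optimal arm absorbs the [c1] of its noise bound. *)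
have h1 : - (lam1 * sigma ^+ 2 / 2) <= (u + c1) / m.
  by rewrite ler_pdivlMr// ; lra.
have h2 : (s + c1) / n * n = s + c1 by rewrite divfK// gt_eqF.
rewrite -h2 mulrC ler_pM2r//; lra.
Qed.

Lemma suboptimal_pulls x : x != astar -> (0 < N T x)%N ->
  ((N T x)%:R - 1) *
    (gap r astar x - (lam1 + lam2) * sigma ^+ 2 / 2) <=
  c1 + 2 / lam2 * ln (peak a Rew r astar sigma lam1 lam2 T x w).
Proof.
move=> xa; set Q := peak _ _ _ _ _ _ _ _ _ _.
have lnQ0 : 0 <= 2 / lam2 * ln Q.
  by rewrite mulr_ge0 ?divr_ge0 ?ler0n ?(ltW lam2_gt0)// ln_ge0// peak_ge1.
(* Induction on time reaches the last pull: rounds with another arm change nothing, and at a pull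
   the new count minus one is the old count. *)
suff : forall t, (t <= T)%N -> (0 < N t x)%N ->
  ((N t x)%:R - 1) * (gap r astar x - (lam1 + lam2) * sigma ^+ 2 / 2) <=
  c1 + 2 / lam2 * ln Q by apply.
elim=> [|t IH] tT; first by rewrite /Npulls big_ord0.
rewrite NpullsS; have [atx|] := eqVneq (a t w) x; last first.
  by rewrite addn0 => _; apply: IH; exact: ltnW.
move=> _; rewrite addn1 -natr1 addrK.
(* The initial rounds have no index comparison, but there the old count is 0. *)
have [tA|At] := ltnP t #|A|.
  by rewrite -atx first_pull// mul0r addr_ge0// ltW.
have := chosen_arm_noise t (ltnW tT) At; rewrite atx.
have : root_wealth a Rew r astar sigma lam1 lam2 t x w <= Q.
  exact/root_wealth_le_peak/ltnW.
have Q0 : 0 < Q by exact: peak_gt0.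
rewrite -[Q in _ <= Q]lnK ?posrE// ler_expR log_wealth_noise /tilt (negbTE xa).
move: (ln Q) (S t x) ((N t x)%:R : R) => l s n le_l le_gap.
(* The peak caps the log-wealth by [2 * ln Q]; division by [lam2] leaves the drift that turns [lam1]
   into [lam1 + lam2]. *)
have le_s : s <= 2 / lam2 * l + n * (lam2 * sigma ^+ 2 / 2).
  have lE : lam2 * (2 / lam2 * l) = 2 * l by field; rewrite gt_eqF.
  by rewrite -(ler_pM2l lam2_gt0) mulrDr lE; lra.
lra.
Qed.

Hypothesis low_arms :
  expR (- (lam2 * c1 * (#|A|%:R + 2) / 4)) *
  \prod_(x | x != astar) arm_potential a Rew r astar sigma lam1 lam2 T x w < 1.

Lemma sum_ln_peak :
  \sum_(x | x != astar) ln (peak a Rew r astar sigma lam1 lam2 T x w) <=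
  lam2 * c1 * (#|A|%:R + 2) / 4.
Proof.
rewrite -subr_le0 -expR_le1 addrC expRD expR_sum; apply/ltW.
apply: le_lt_trans low_arms; rewrite ler_wpM2l ?expR_ge0//.
apply: ler_prod => x _; rewrite expR_ge0 lnK ?posrE ?peak_gt0//.
exact: peak_le_arm_potential.
Qed.

Hypothesis astar_max : forall x, r x <= r astar.

Lemma regret_Npulls : regret r astar a T w =
  \sum_(x : A) (N T x)%:R * gap r astar x.
Proof.
rewrite /regret (partition_big (fun i : 'I_T => a i w) predT)//=.
apply: eq_bigr => x _; rewrite /Npulls natr_sum mulr_suml.
by apply: eq_bigr => i /eqP ->; rewrite mul1r.
Qed.

Lemma regret_le : regret r astar a T w <=
  (lam1 + lam2) * sigma ^+ 2 / 2 * T%:R + 3 / 2 * c1 * #|A|%:R +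
  \sum_(x : A) gap r astar x.
Proof.
set e := (lam1 + lam2) * sigma ^+ 2 / 2.
have e0 : 0 <= e by rewrite mulr_ge0// mulr_ge0 ?sqr_ge0// addr_ge0 ?ltW.
have gap0 x : 0 <= gap r astar x by rewrite subr_ge0.
rewrite regret_Npulls.
(* The single [gap] of each arm pays for its last pull. *)
apply: (@le_trans _ _ (\sum_(x : A) (gap r astar x + e * (N T x)%:R) +
  \sum_(x | x != astar)
    (c1 + 2 / lam2 * ln (peak a Rew r astar sigma lam1 lam2 T x w)))).
  rewrite [X in _ <= _ + X]big_mkcond -big_split/=; apply: ler_sum => x _.
  have [->|xa] := eqVneq x astar.
    by rewrite /gap subrr mulr0 add0r addr0 mulr_ge0// ler0n.
  have [N0|N0] := posnP (N T x).
    rewrite N0 mul0r mulr0 addr0 addr_ge0// addr_ge0 ?(ltW c1_gt0)//.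
    by rewrite mulr_ge0 ?divr_ge0 ?(ltW lam2_gt0)// ln_ge0// peak_ge1.
  by have := suboptimal_pulls x xa N0; rewrite -/e /=; lra.
rewrite !big_split/= -!mulr_sumr -natr_sum sum_Npulls.
have -> : \sum_(x | x != astar) c1 = c1 * (#|A|%:R - 1).
  have A0 : (0 < #|A|)%N by apply/card_gt0P; exists astar.
  by rewrite sumr_const cardC1 -(mulr_natr c1) -[in RHS](prednK A0) -natr1 addrK.
have := sum_ln_peak; move: (\sum_(x | _) ln _) => l le_l.
(* The [#|A| + 2] in [low_arms] is chosen so that adding [c1 * (#|A| - 1)] gives
   [3 / 2 * c1 * #|A|]. *)
have : 2 / lam2 * l <= c1 * (#|A|%:R + 2) / 2.
  have lE : lam2 * (2 / lam2 * l) = 2 * l by field; rewrite gt_eqF.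
  by rewrite -(ler_pM2l lam2_gt0) lE; lra.
lra.
Qed.

End Run.

(** * Choice of the parameters and conclusion *)

Theorem theorem1 (R : realType) (A : finType) (d : measure_display)
    (Omega : measurableType d) (P : probability Omega R)
    (sigma c1 : R) (r : A -> R) (astar : A)
    (a : nat -> Omega -> A) (Rew : nat -> Omega -> R) :
  0 <= sigma ->
  0 < c1 ->
  (forall x, 0 <= r x <= 1) ->
  (forall x, r x <= r astar) ->
  (* measurability of the process *)
  (forall t x, measurable (a t @^-1` [set x])) ->
  (forall t, measurable_fun setT (Rew t)) ->
  (* conditional mean zero and conditional sigma^2-sub-Gaussian noise given
     sigma(F_{t-1}, a_t), written out with events of that sigma-algebra *)
  (forall t, P.-integrable setT (fun w => (Rew t w - r (a t w))%:E)) ->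
  (forall t B, <<s hist_gen a Rew t>> B ->
     (\int[P]_(w in B) (Rew t w - r (a t w))%:E = 0)%E) ->
  (forall t B (lam : R), <<s hist_gen a Rew t>> B ->
     (\int[P]_(w in B) (expR (lam * (Rew t w - r (a t w))))%:E
        <= (expR (lam ^+ 2 * sigma ^+ 2 / 2))%:E * P B)%E) ->
  (* the algorithm: Bandit EQO+ with c_{1,t} = c1, c_{2,t} = +oo *)
  is_EQOplus_run (fun _ => c1%:E) (fun _ => +oo%E) a Rew ->
  forall (T : nat) (delta : R), 0 < delta <= 1 ->
    (dist_regret P (regret r astar a T) delta
      <= (sigma ^+ 2 * T%:R * ln (4 / delta) / c1
          + 3 / 2 * c1 * #|A|%:R
          + \sum_(x : A) gap r astar x)%:E)%E.
Proof.
move=> _ c1_gt0 _ astar_max ma mRew _ _ subgauss run T delta /andP[d0 d1].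
set bound := _ + _ + _.
have mreg : measurable_fun [set: Omega] (regret r astar a T).
  apply: measurable_sum => t.
  exact: (@measurable_fun_finite_select _ _ _ _ _ (a t) (fun x _ => gap r astar x)).
pose E := [set w | bound < regret r astar a T w].
have mE : measurable E.
  rewrite (_ : E = regret r astar a T @^-1` `]bound, +oo[).
    by rewrite -[X in measurable X]setTI; exact: mreg.
  by apply/seteqP; split=> w; rewrite /E /= in_itv/= andbT.
suff PE : (P E <= delta%:E)%E by apply: ereal_inf_lbound; exists bound.
(* At [delta = 1] the choice below would give [p = 1] and [lam1 = 0]. *)
move: d1; rewrite le_eqVlt => /predU1P[->|d1]; first exact: probability_le1.
have A_gt0 : (0 < #|A|)%N by apply/card_gt0P; exists astar.
(* A single arm has no regret; the bound on [q] below needs a suboptimal arm. *)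
have [A1|A2] := leqP #|A| 1.
  rewrite (_ : E = set0) ?measure0 ?lee_fin ?ltW//.
  have gap0 x : gap r astar x = 0.
    by rewrite /gap (fintype_le1P A1 x astar) subrr.
  apply/seteqP; split=> // w; rewrite /E /= ltNge => /negP; apply.
  rewrite /regret big1// /bound big1// addr0 addr_ge0//.
    apply: divr_ge0 (ltW c1_gt0); apply: mulr_ge0; last first.
      by rewrite ln_ge0// ler_pdivlMr//; lra.
    by apply: mulr_ge0; rewrite ?sqr_ge0 ?ler0n.
  by rewrite !mulr_ge0// ltW.
pose p := delta * (1 + delta) / 2.
pose K := ln (8 * (1 + delta) / delta).
pose lam1 := - ln p / c1.
pose lam2 := K / c1.
pose q := expR (- (lam2 * c1 * (#|A|%:R + 2) / 4)).
have p0 : 0 < p by rewrite /p; nra.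
have p1 : p < 1 by rewrite /p; nra.
have D0 : 0 < 8 * (1 + delta) / delta by rewrite divr_gt0//; lra.
have lam1_gt0 : 0 < lam1 by rewrite divr_gt0// oppr_gt0 ln_lt0// p0.
(* As [delta <= 1], the argument of [K] is at least 16, so each further arm shrinks [q] by
   [expR (- (K / 4)) <= 1 / 2], which pays for its factor 2. *)
have K4 : 4 * ln 2 <= K.
  rewrite mulr_natl -lnXn// /K ler_ln ?posrE// ?exprn_gt0// ler_pdivlMr//; lra.
have ln2 : 0 < ln 2 :> R by rewrite ln_gt0// ltr1n.
have lam2_gt0 : 0 < lam2 by rewrite divr_gt0//; lra.
have lam2c1 : lam2 * c1 = K by rewrite /lam2 divfK// gt_eqF.
have pE : p = expR (- (lam1 * c1)).
  by rewrite /lam1 divfK ?gt_eqF// opprK lnK.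
have boundE : bound = (lam1 + lam2) * sigma ^+ 2 / 2 * T%:R +
    3 / 2 * c1 * #|A|%:R + \sum_(x : A) gap r astar x.
  congr (_ + _ + _).
  have -> : lam1 + lam2 = 2 * ln (4 / delta) / c1.
    rewrite /lam1 /lam2 -mulrDl; congr (_ / _).
    rewrite mulr_natl -lnXn ?divr_gt0// addrC /K -ln_div ?posrE//.
    by congr ln; rewrite /p; field; rewrite !gt_eqF//; lra.
  by field; rewrite gt_eqF.
have q_le : q * 2 ^+ #|A|.-1 <= delta / (2 + delta).
  have -> : (2 : R) ^+ #|A|.-1 = expR (#|A|.-1%:R * ln 2).
    by rewrite expRM_natl lnK ?posrE.
  (* The worst case is two arms, where the exponent equals [ln 2 - K]. *)
  apply: (@le_trans _ _ (expR (ln 2 - K))).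
    rewrite /q -expRD ler_expR lam2c1.
    have : 1 <= #|A|.-1%:R :> R by rewrite ler1n -ltnS prednK.
    have -> : #|A|%:R = #|A|.-1%:R + 1 :> R by rewrite natr1 prednK.
    by move: (#|A|.-1%:R : R) => m m1; nra.
  rewrite expRB !lnK ?posrE// invf_div mulrA ler_pdivrMr; last lra.
  rewrite mulrAC ler_pdivlMr; last lra.
  by nra.
apply: (@le_trans _ _ (p + (1 - p) * (q * 2 ^+ #|A|.-1))%:E).
  (* A potential below 1 forces both processes below 1, and then [regret_le] excludes the failure
     event. *)
  apply: (@probability_potential_le _ _ _ _ P a Rew r astar sigma lam1 lam2 p q
    (ltW p0) (expR_ge0 _) ma mRew subgauss (ltW p1) T) => // w Ew.
  rewrite leNgt; apply/negP => pot1; move: Ew; rewrite /E /= ltNge => /negP; apply.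
  rewrite boundE.
  have [u1 v1] : frozen_wealth a Rew r astar sigma lam1 lam2 p T w < 1 /\
      arms_potential a Rew r astar sigma lam1 lam2 q T w < 1.
    split; rewrite ltNge; apply/negP => ge1; move: pot1; rewrite /potential.
      by rewrite {1 2}/optimal_risk min_l// subrr mul0r addr0 ltxx.
    by rewrite {1}/arms_risk min_l// mulr1 addrC subrK ltxx.
  exact: regret_le u1 v1 astar_max.
rewrite lee_fin.
apply: (@le_trans _ _ (p + (1 - p) * (delta / (2 + delta)))).
  by rewrite lerD2l ler_wpM2l// subr_ge0 ltW.
(* Since [1 - p = (1 - delta) * (2 + delta) / 2] and the other complement is [2 / (2 + delta)], the
   total is exactly [delta]. *)
rewrite /p le_eqVlt; apply/orP; left; apply/eqP; field; rewrite gt_eqF//; lra.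
Qed.
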